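(* For each fixed integer $r \geq 1$, $$AW(k;r) \leq \frac{k^{2r-1}}{(2r-1)!}\,(1+o(1)) \quad \text{as } k\to\infty .$$
   Context: A sequence of positive integers $w_1<w_2<\dots<w_n$ is an ascending wave if $w_{i+1}-w_i \geq w_i-w_{i-1}$ for $2\le i\le n-1$. For positive integers $k,r$, $AW(k;r)$ denotes the least positive integer $N$ such that every $r$-coloring of $\{1,2,\dots,N\}$ contains a $k$-term monochromatic ascending wave. *)

(* Defs.v *)
From mathcomp Require Import all_boot all_order all_algebra.
Set Implicit Arguments. Unset Strict Implicit. Unset Printing Implicit Defensive.
Import Order.TTheory GRing.Theory Num.Theory.

Definition ascending_wave (w : seq nat) : Prop :=
  sorted ltn w /\
  forall i, i.+2 < size w ->
    nth 0 w i.+1 - nth 0 w i <= nth 0 w i.+2 - nth 0 w i.+1.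

(* Every r-coloring of {1,...,N} contains a k-term monochromatic
   ascending wave.  A coloring is any c : nat -> 'I_r; only its values on
   {1,...,N} matter. *)
Definition AW_property (k r N : nat) : Prop :=
  forall c : nat -> 'I_r,
    exists w : seq nat,
      [/\ size w = k,
          all (fun x => 1 <= x <= N) w,
          ascending_wave w &
          exists col : 'I_r, all (fun x => c x == col) w].

Definition is_AW (k r N : nat) : Prop :=
  0 < N /\ AW_property k r N /\
  forall M, 0 < M -> AW_property k r M -> N <= M.

(* Main.v *)
(** Writing [f r k] for a length that forces a [k]-term monochromatic wave with
    [r] colours, we have [f (r+1) (k+1) <= f (r+1) k + D (k+1)] where
    [D (k+1) = D k + f r (k+1)] bounds the last difference. Indeed, let a
    [k]-term wave of colour [col] end at [y] with last difference at most [D k],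
    and look at the window of length [f r (k+1)] starting at [y + D k]. If [col]
    occurs in it, the wave is extended there; otherwise the window carries only
    [r] colours, hence contains a whole new [k+1]-term wave, whose differences are
    smaller than the window. With [f 1 k = k] the recursion is Pascal's rule and
    gives [AW(k;r) <= 'C(k + 2r - 2, 2r - 1)]. *)
Require Import Defs.
From mathcomp Require Import all_boot all_order all_algebra.
From mathcomp Require Import zify lra.
From Stdlib Require Import Classical.
Import Order.TTheory GRing.Theory Num.Theory.

(* For a one-term wave the index [(size w).-2] truncates to [0] and the gap is [0]. *)
Definition last_gap (w : seq nat) : nat := last 0 w - nth 0 w (size w).-2.

(** Only the triple ending at [z] is new, and its earlier difference is [last_gap w]. *)
Lemma ascending_wave_rcons (w : seq nat) (z : nat) :
  ascending_wave w -> 0 < size w -> last 0 w < z ->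
  last_gap w <= z - last 0 w -> ascending_wave (rcons w z).
Proof.
move=> [srt_w dif_w] w_gt0 lt_z gap_z; split.
  case: w srt_w w_gt0 lt_z {dif_w gap_z} => // x s /= pth _ lt_z.
  by rewrite rcons_path pth.
move=> i; rewrite size_rcons ltnS => le_i.
have [lt_i|ge_i] := ltnP i.+2 (size w).
  rewrite !nth_rcons lt_i (ltnW lt_i) (ltnW (ltnW lt_i)).
  exact: dif_w.
have size_w : size w = i.+2 by apply/eqP; rewrite eqn_leq le_i ge_i.
rewrite !nth_rcons size_w eqxx ltnn leqnn leqnSn.
by move: gap_z; rewrite /last_gap -nth_last size_w.
Qed.

Lemma last_gap_rcons (w : seq nat) (z : nat) :
  0 < size w -> last_gap (rcons w z) = z - last 0 w.
Proof.
move=> w_gt0; rewrite /last_gap last_rcons size_rcons nth_rcons /= -nth_last.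
by case: (size w) w_gt0 => // n _; rewrite ltnSn.
Qed.

Definition mono_wave_in (T : eqType) (c : nat -> T) (a L k : nat) (w : seq nat) :=
  [/\ size w = k, all (fun x => a <= x < a + L) w, ascending_wave w &
      exists col, all (fun x => c x == col) w].

Lemma last_gap_lt (a L : nat) (w : seq nat) :
  0 < size w -> all (fun x => a <= x < a + L) w -> last_gap w < L.
Proof.
move=> w_gt0 /allP w_in.
have /w_in : last 0 w \in w by rewrite -nth_last mem_nth ?prednK.
have /w_in : nth 0 w (size w).-2 \in w.
  by apply: mem_nth; case: (size w) w_gt0 => [|[|n]] //= _; rewrite leqnSn.
by rewrite /last_gap /= => ? ?; lia.
Qed.

Lemma iota_mono_wave (T : eqType) (c : nat -> T) (col : T) (a k : nat) :
  (forall x, a <= x < a + k -> c x = col) -> mono_wave_in T c a k k (iota a k).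
Proof.
move=> mono; split; first by rewrite size_iota.
- by apply/allP => x; rewrite mem_iota.
- split; first exact: iota_ltn_sorted.
  by move=> i; rewrite size_iota => lt_i; rewrite !nth_iota; lia.
- by exists col; apply/allP => x; rewrite mem_iota => /mono ->.
Qed.

(** A palette [C] and a free starting point [a] let the induction on [r] pass to a later window from
    which one colour has been removed. *)
Lemma mono_wave_exists (T : finType) (c : nat -> T) (r p : nat) (C : {set T})
    (a : nat) :
  #|C| <= r.+1 ->
  (forall x, a <= x < a + 'C(p.+1 + r.*2, r.*2.+1) -> c x \in C) ->
  exists w, mono_wave_in T c a 'C(p.+1 + r.*2, r.*2.+1) p.+1 w.
Proof.
elim: r p C a => [|r IHr] p C a card_C col_C.
  rewrite addn0 bin1 in col_C *.
  exists (iota a p.+1); apply: (@iota_mono_wave _ _ (c a)) => x x_in.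
  by apply: (card_le1_eqP card_C); apply: col_C; lia.
(* For waves of [p.+1] terms, [A p] and [f p] are the window lengths for [r.+1] and [r.+2] colours,
   and [D p] bounds the last gap. Both recurrences below are Pascal's rule. *)
pose D p := 'C(p.+1 + r.*2.+1, r.*2.+2).
pose f p := 'C(p.+1 + r.*2.+2, r.*2.+3).
pose A p := 'C(p.+1 + r.*2, r.*2.+1).
have DS q : D q.+1 = D q + A q.+1.
  by rewrite /D /A !addSn !addnS binS.
have fS q : f q.+1 = f q + D q.+1.
  by rewrite /f /D !addSn !addnS binS.
have A_gt0 q : 0 < A q by rewrite bin_gt0; lia.
have D_gt0 q : 0 < D q by rewrite bin_gt0; lia.
have f_gt0 q : 0 < f q by rewrite bin_gt0; lia.
rewrite doubleS -/(f p) in col_C *.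
suff [w []] : exists w, mono_wave_in T c a (f p) p.+1 w /\ last_gap w <= D p.
  by exists w.
elim: p col_C => [|p IHp] col_C.
  exists [:: a]; split; last by rewrite /last_gap /= subnn.
  split=> //=; first by rewrite leqnn -ltn_psubLR ?subnn ?f_gt0.
  by exists (c a); rewrite eqxx.
have [|w [[size_w in_w asc_w [col col_w]] gap_w]] := IHp.
  by move=> x x_in; apply: col_C; rewrite fS; lia.
have w_gt0 : 0 < size w by rewrite size_w.
set y := last 0 w.
have y_w : y \in w by rewrite /y -nth_last mem_nth ?prednK.
have y_in : a <= y < a + f p by exact: (allP in_w).
have c_y : c y = col by apply/eqP/(allP col_w).
have col_in : col \in C by rewrite -c_y col_C // fS; lia.
(* Starting at [y + D p] makes the new gap at least the old one; ending before [y + D p.+1] keeps it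
   within the new bound and inside the window of length [f p.+1]. *)
have [/hasP[x]|/hasPn no_col] :=
  boolP (has (fun x => c x == col) (iota (y + D p) (A p.+1))).
  rewrite mem_iota => x_in c_x; exists (rcons w x); split.
  2: by rewrite last_gap_rcons // -/y DS; lia.
  split; first by rewrite size_rcons size_w.
  - rewrite all_rcons; apply/andP; split; first by rewrite fS DS; lia.
    by apply: sub_all in_w => z /=; rewrite fS; lia.
  (* [D p > 0] gives the strict inequality [y < x]. *)
  - by have := D_gt0 p; move=> ?; apply: ascending_wave_rcons; rewrite -/y //; lia.
  - by exists col; rewrite all_rcons c_x.
have [||w' [size_w' in_w' asc_w' mono_w']] := IHr p.+1 (C :\ col) (y + D p).
- by have := cardsD1 col C; rewrite col_in; lia.
- move=> x x_in; rewrite in_setD1 no_col ?mem_iota // col_C // fS DS.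
  by rewrite -/(A p.+1) in x_in; lia.
rewrite -/(A p.+1) in in_w'.
exists w'; split.
  split=> //; apply: sub_all in_w' => x /=; rewrite fS DS; lia.
have : last_gap w' < A p.+1 by apply: last_gap_lt in_w'; rewrite size_w'.
by rewrite DS; lia.
Qed.

Lemma AW_property_bin (k r : nat) :
  0 < k -> AW_property k r.+1 'C(k + r.*2, r.*2.+1).
Proof.
case: k => // p _ c.
have [||w [size_w in_w asc_w mono_w]] :=
  @mono_wave_exists _ c r p [set: 'I_r.+1] 1.
- by rewrite cardsT card_ord.
- by move=> x _; rewrite inE.
by exists w; split=> //; apply: sub_all in_w => x; rewrite add1n ltnS.
Qed.

(** Excluded middle supplies the minimum, since [AW_property] quantifies over all colourings and is
    not a boolean predicate. *)
Lemma is_AW_exists (k r N : nat) :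
  0 < N -> AW_property k r N -> exists2 M, is_AW k r M & M <= N.
Proof.
elim/ltn_ind: N => N IHN N_gt0 AW_N.
have [[M [M_gt0 [AW_M lt_MN]]]|no_less] :=
  classic (exists M, 0 < M /\ (AW_property k r M /\ M < N)).
  have [M' AW_M' le_M'] := IHN M lt_MN M_gt0 AW_M.
  by exists M' => //; lia.
exists N => //; split=> //; split=> // M M_gt0 AW_M.
rewrite leqNgt; apply/negP => lt_MN; apply: no_less.
by exists M.
Qed.

Lemma ffact_leq_exp (n m : nat) : n ^_ m <= n ^ m.
Proof.
elim: m => // m IHm; rewrite ffactnSr expnSr.
by rewrite leq_mul // leq_subr.
Qed.

Local Open Scope ring_scope.

(* Bernoulli's inequality for [(k / (k + a)) ^+ n], with denominators cleared. *)
Lemma bernoulli_shift (R : realDomainType) (k a : R) (n : nat) :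
  0 <= k -> 0 <= a -> (k + a) ^+ n * (k - a *+ n) <= k ^+ n.+1.
Proof.
move=> k_ge0 a_ge0; elim: n => [|n IHn].
  by rewrite expr0 mul1r mulr0n subr0 expr1.
have X_ge0 : 0 <= (k + a) ^+ n by rewrite exprn_ge0 ?addr_ge0.
have na_ge0 : 0 <= a *+ n by rewrite mulrn_wge0.
(* Here [(k + a) * (k - (n + 1) * a) <= k * (k - n * a)]: the two sides differ by
   [(n + 1) * a ^ 2]. *)
apply: le_trans (_ : k * ((k + a) ^+ n * (k - a *+ n)) <= _).
  rewrite exprSr -mulrA [k * _]mulrCA ler_wpM2l // mulrS.
  by nra.
by rewrite [k ^+ n.+2]exprS ler_wpM2l.
Qed.

Lemma expr_shift_asymp (a n : nat) (eps : rat) : 0 < eps ->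
  (* The threshold [t] is chosen so that [k > t] means [k < (1 + eps) * (k - a * n)]. *)
  exists2 K : nat, (0 < K)%N & forall k : nat, (K <= k)%N ->
    (k + a)%:R ^+ n <= (1 + eps) * k%:R ^+ n :> rat.
Proof.
move=> eps_gt0; set t : rat := (a * n)%:R * (1 + eps) / eps.
exists (Num.bound t).+1 => // k le_k.
have t_ge0 : 0 <= t by rewrite divr_ge0 ?mulr_ge0 ?ler0n ?addr_ge0 // ltW.
have lt_t : t < k%:R.
  apply: lt_le_trans (archi_boundP t_ge0) _.
  by rewrite ler_nat ltnW.
have k_gt0 : 0 < k%:R :> rat by apply: le_lt_trans lt_t.
rewrite -(ler_pM2r k_gt0) -mulrA -exprSr natrD.
have := @bernoulli_shift _ (k%:R : rat) a%:R n (ltW k_gt0) (ler0n _ _).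
rewrite -mulrnA; set X := (_ + _) ^+ n; set Y := _ ^+ n.+1 => le_XY.
have X_ge0 : 0 <= X by rewrite exprn_ge0 ?addr_ge0 ?ler0n.
move: lt_t; rewrite /t ltr_pdivrMr // => lt_t.
apply: le_trans (_ : (1 + eps) * (X * (k%:R - (a * n)%:R)) <= _); last first.
  by rewrite ler_pM2l // addr_gt0.
rewrite mulrCA ler_wpM2l //.
by nra.
Qed.

Theorem theorem1 (r : nat) (hr : (1 <= r)%N) :
  forall eps : rat, 0 < eps ->
  exists K : nat, forall k : nat, (K <= k)%N ->
    exists N : nat, is_AW k r N /\
      (N%:R : rat) <= (1 + eps) * ((k ^ (2 * r - 1))%N%:R / ((2 * r - 1)`!)%N%:R).
Proof.
case: r hr => // r _ eps eps_gt0.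
have -> : (2 * r.+1 - 1 = r.*2.+1)%N by lia.
have [K K_gt0 asymp] := @expr_shift_asymp r.*2 r.*2.+1 eps eps_gt0.
exists K => k le_k.
have k_gt0 : (0 < k)%N by exact: leq_trans le_k.
have [||N AW_N le_N] := @is_AW_exists k r.+1 'C(k + r.*2, r.*2.+1).
- by rewrite bin_gt0; lia.
- exact: AW_property_bin.
exists N; split=> //.
have fact_pos : 0 < (r.*2.+1)`!%:R :> rat by rewrite ltr0n fact_gt0.
rewrite mulrA ler_pdivlMr // natrX.
apply: le_trans (asymp k le_k).
rewrite -natrM -natrX ler_nat.
(* The binomial times the factorial is a falling factorial, at most [(k + r.*2) ^ r.*2.+1]. *)
apply: leq_trans (_ : _ <= 'C(k + r.*2, r.*2.+1) * (r.*2.+1)`!)%N _.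
  by rewrite leq_mul2r le_N orbT.
by rewrite bin_ffact ffact_leq_exp.
Qed.
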